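(* Let $R$ be a Noetherian domain. The following conditions are equivalent: (1) $R$ is strongly $t$-stable; (2) $R$ is Boole $t$-regular and $t\text{-}\dim(R)=1$.
   Context: All rings are integral domains (commutative with $1$). Let $R$ be a domain with quotient field $F=\mathrm{qf}(R)$. For nonzero $R$-submodules $A,B$ of $F$, $(A:B):=\{x\in F : xB\subseteq A\}$. For a nonzero fractional ideal $I$ of $R$: $I^{-1}:=(R:I)$, $I_v:=(I^{-1})^{-1}$, and $I_t:=\bigcup J_v$, where $J$ ranges over the nonzero finitely generated fractional subideals of $I$. $I$ is a $t$-ideal if $I=I_t$ ($t$-ideals are nonzero fractional ideals). The $t$-class semigroup $\mathcal{S}_t(R)$ is the commutative semigroup of fractional $t$-ideals of $R$ under the $t$-multiplication $(I,J)\mapsto (IJ)_t$, modulo its subsemigroup of nonzero principal fractional ideals; i.e. $t$-ideals $I,J$ have the same class iff $J=cI$ for some $0\neq c\in F$. A semigroup $S$ is Boolean if $x=x^2$ for each $x\in S$. $R$ is Boole $t$-regular if $\mathcal{S}_t(R)$ is a Boolean semigroup. A nonzero ideal $I$ of $R$ is strongly stable if it is principal in its endomorphism ring $(I:I)$, i.e. $I=a(I:I)$ for some $a\in F$. $R$ is strongly $t$-stable if each $t$-ideal of $R$ is strongly stable. A $t$-prime ideal is a nonzero prime ideal of $R$ that is a $t$-ideal. The $t$-dimension $t\text{-}\dim(R)$ is the length of the longest chain of $t$-prime ideals of $R$, where $(0)$ is included as the bottom of the chain: a chain $(0)\subsetneq P_1\subsetneq\cdots\subsetneq P_n$ with each $P_i$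 a $t$-prime has length $n$.
   Formalization: The formal theorem assumes in addition that R is not a field; for a field, R is strongly t-stable but t-dim(R) = 0, so the equivalence as stated fails. *)

(* Defs.v *)
From HB Require Import structures.
From mathcomp Require Import all_boot all_order all_algebra.
From mathcomp Require Import boolp classical_sets cardinality.
Set Implicit Arguments.
Unset Strict Implicit.
Unset Printing Implicit Defensive.
Import GRing.Theory.
Local Open Scope classical_set_scope.
Local Open Scope ring_scope.
Local Open Scope quotient_scope.

Notation "x %:F" := (@FracField.tofrac _ x) (at level 1, format "x %:F").

(** * Ideals of R *)

(* Unlike [idealr_closed], this predicate allows the unit ideal. *)
Definition ideal (R : idomainType) (I : set R) : Prop :=
  [/\ I 0, forall x y, I x -> I y -> I (x + y) & forall r x, I x -> I (r * x)].

Definition noetherian (R : idomainType) : Prop :=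
  forall I : set R, ideal I -> exists2 X, finite_set X & I = smallest (@ideal R) X.

(** * R-submodules of the quotient field *)

Definition submod (R : idomainType) (A : set {fraction R}) : Prop :=
  [/\ A 0, forall x y, A x -> A y -> A (x + y)
    & forall (r : R) x, A x -> A (r%:F * x)].

Definition gen (R : idomainType) (X : set {fraction R}) : set {fraction R} :=
  smallest (@submod R) X.

Definition ring_set (R : idomainType) : set {fraction R} :=
  range (@FracField.tofrac R).

(* Fractional ideals are nonzero throughout. *)
Definition frac_ideal (R : idomainType) (I : set {fraction R}) : Prop :=
  [/\ submod I, exists2 x, I x & x != 0
    & exists2 d : R, d != 0 & forall x, I x -> ring_set (d%:F * x)].

Definition colon (R : idomainType) (A B : set {fraction R}) :
  set {fraction R} := [set x | forall y, B y -> A (x * y)].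

Definition prod_ideal (R : idomainType) (A B : set {fraction R}) :
  set {fraction R} := gen [set a * b | a in A & b in B].

Definition scale (R : idomainType) (c : {fraction R}) (A : set {fraction R}) :
  set {fraction R} := [set c * x | x in A].

(** * The v- and t-operations *)

Definition inv_ideal (R : idomainType) (I : set {fraction R}) :=
  colon (@ring_set R) I.

Definition v_closure (R : idomainType) (I : set {fraction R}) :=
  inv_ideal (inv_ideal I).

Definition fg_frac_ideal (R : idomainType) (J : set {fraction R}) : Prop :=
  frac_ideal J /\ exists2 X, finite_set X & J = gen X.

Definition t_closure (R : idomainType) (I : set {fraction R}) :
    set {fraction R} :=
  \bigcup_(J in [set J | fg_frac_ideal J /\ J `<=` I]) v_closure J.

Definition t_ideal (R : idomainType) (I : set {fraction R}) : Prop :=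
  frac_ideal I /\ t_closure I = I.

Definition strongly_stable (R : idomainType) (I : set {fraction R}) : Prop :=
  exists a, I = scale a (colon I I).

Definition strongly_t_stable (R : idomainType) : Prop :=
  forall I : set {fraction R}, t_ideal I -> strongly_stable I.

(** * t-dimension *)

(* [idealr_closed] includes 1 \notin P; that P is nonzero is part of
   [t_ideal]. *)
Definition t_prime (R : idomainType) (P : set R) : Prop :=
  [/\ idealr_closed (mem P), prime_idealr_closed (mem P)
    & t_ideal (@FracField.tofrac R @` P)].

(* P 0 = (0) < P 1 < ... < P n; the values P i with i > n are irrelevant. *)
Definition t_prime_chain (R : idomainType) (n : nat) (P : nat -> set R) : Prop :=
  [/\ P 0%N = [set 0], forall i, (i < n)%N -> P i `<` P i.+1
    & forall i, (0 < i <= n)%N -> t_prime (P i)].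

Definition t_dim_eq (R : idomainType) (n : nat) : Prop :=
  (exists P : nat -> set R, t_prime_chain n P) /\
  (forall m (P : nat -> set R), t_prime_chain m P -> (m <= n)%N).

(** * Auxiliary facts on the t-operation *)

Section Theory.
Context (R : idomainType).
Local Notation F := {fraction R}.
Implicit Types (A B C I J K M X Y : set F) (c x y z : F).

Lemma submod_gen X : submod (gen X).
Proof.
split.
- by move=> M [[]].
- move=> x y hx hy M hM; move: (hM) => [[_ h _] _].
  by apply: h; [apply: hx|apply: hy].
- move=> r x hx M hM; move: (hM) => [[_ _ h] _]; apply: h; exact: hx.
Qed.

Lemma sub_gen X : X `<=` gen X. Proof. exact: sub_gen_smallest. Qed.

Lemma gen_sub X M : submod M -> X `<=` M -> gen X `<=` M.
Proof. exact: smallest_sub. Qed.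

Lemma submod_ring : submod (@ring_set R).
Proof.
split; first by exists 0; rewrite // rmorph0.
  by move=> _ _ [x _ <-] [y _ <-]; exists (x + y); rewrite // rmorphD.
by move=> r _ [x _ <-]; exists (r * x); rewrite // rmorphM.
Qed.

Lemma submod_colon A B : submod A -> submod (colon A B).
Proof.
move=> [A0 AD AZ]; split.
- by move=> y _; rewrite mul0r.
- by move=> x y hx hy z Bz; rewrite mulrDl; apply: AD; [exact: hx|exact: hy].
- by move=> r x hx z Bz; rewrite -mulrA; apply: AZ; exact: hx.
Qed.

Lemma submod_inv A : submod (inv_ideal A).
Proof. exact/submod_colon/submod_ring. Qed.

Lemma submod_v A : submod (v_closure A). Proof. exact: submod_inv. Qed.

Lemma inv_ideal_anti A B : A `<=` B -> inv_ideal B `<=` inv_ideal A.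
Proof. by move=> AB x hx y Ay; apply/hx/AB. Qed.

Lemma v_closure_mono A B : A `<=` B -> v_closure A `<=` v_closure B.
Proof. by move=> AB; do 2!apply: inv_ideal_anti. Qed.

Lemma v_closure_sub A : A `<=` v_closure A.
Proof. by move=> x Ax y hy; rewrite mulrC; exact: hy. Qed.

Lemma v_closure_idem A : v_closure (v_closure A) `<=` v_closure A.
Proof. by apply: inv_ideal_anti; exact: v_closure_sub. Qed.

Lemma v_closure_scale c A : scale c (v_closure A) `<=` v_closure (scale c A).
Proof.
move=> _ [x Ax <-] y hy; rewrite mulrAC mulrC; apply: Ax => z Az.
rewrite mulrAC -mulrA mulrC -mulrA mulrC -mulrA [X in ring_set X](_ : _ = y * (c * z)).
  by apply: hy; exists z.
by rewrite mulrCA.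
Qed.

Lemma fg_sub X I : frac_ideal I -> finite_set X -> X `<=` I ->
  exists J, [/\ fg_frac_ideal J, J `<=` I & X `<=` J].
Proof.
move=> [mI [x0 Ix0 x00] [d d0 dI]] fX XI.
have sI : gen (x0 |` X) `<=` I.
  by apply: gen_sub => // y [->|/XI].
exists (gen (x0 |` X)); split => //.
- split; last first.
    by exists (x0 |` X) => //; rewrite finite_setU; split => //; exact: finite_set1.
  split; first exact: submod_gen.
    by exists x0 => //; apply: sub_gen; left.
  by exists d => // x /sI /dI.
- by move=> x Xx; apply: sub_gen; right.
Qed.

Lemma fg_directed I J K : frac_ideal I ->
    fg_frac_ideal J -> J `<=` I -> fg_frac_ideal K -> K `<=` I ->
  exists L, [/\ fg_frac_ideal L, L `<=` I, J `<=` L & K `<=` L].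
Proof.
move=> fI [_ [X fX ->]] JI [_ [Y fY ->]] KI.
have [||L [fL LI XL]] := @fg_sub (X `|` Y) I fI.
- by rewrite finite_setU.
- by move=> x [/sub_gen/JI|/sub_gen/KI].
- exists L; split => //; apply: gen_sub; try by case: fL => [[]].
  + by move=> x Xx; apply: XL; left.
  + by move=> x Xx; apply: XL; right.
Qed.

Lemma t_closure_sub I : frac_ideal I -> I `<=` t_closure I.
Proof.
move=> fI x Ix.
have [||J [fJ JI xJ]] := @fg_sub [set x] I fI; first exact: finite_set1.
  by move=> _ ->.
by exists J => //; apply/v_closure_sub/xJ.
Qed.

Lemma t_closure_mono I J : I `<=` J -> t_closure I `<=` t_closure J.
Proof.
move=> IJ x [K [fK KI] Kx]; exists K => //; split => //.
exact: subset_trans IJ.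
Qed.

Lemma frac_ideal_t I : frac_ideal I -> frac_ideal (t_closure I).
Proof.
move=> fI; have := fI => -[mI [x0 Ix0 x00] [d d0 dI]]; split.
- split; first by apply: t_closure_sub => //; case: mI.
  + move=> x y [J [fJ JI] Jx] [K [fK KI] Ky].
    have [L [fL LI JL KL]] := fg_directed fI fJ JI fK KI.
    exists L => //; case: (submod_v L) => _ h _; apply: h.
    * exact: v_closure_mono Jx.
    * exact: v_closure_mono Ky.
  + move=> r x [J [fJ JI] Jx]; exists J => //.
    by case: (submod_v J) => _ _; apply.
- by exists x0 => //; exact: t_closure_sub.
- exists d => // x [J [fJ JI] Jx]; rewrite mulrC; apply: Jx => y Jy.
  exact/dI/JI.
Qed.

Lemma t_closure_idem I : frac_ideal I -> t_closure (t_closure I) = t_closure I.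
Proof.
move=> fI; apply/seteqP; split; last exact/t_closure_sub/frac_ideal_t.
move=> x [J [[_ [X fX ->]] JI] Jx].
have {}JI : X `<=` t_closure I by apply: subset_trans JI; exact: sub_gen.
have [K [fK KI XK]] :
    exists K, [/\ fg_frac_ideal K, K `<=` I & X `<=` v_closure K].
  move/finite_seqP: fX JI {Jx} => [s ->]; elim: s => [_|y s IH sI].
    have [||K [fK KI _]] := @fg_sub set0 I fI; first exact: finite_set0.
      by [].
    by exists K; split.
  have [z zs|K [fK KI sK]] := IH.
    by apply: sI; rewrite /= inE zs orbT.
  have [|L [fL LI] Ly] := sI y; first by rewrite /= mem_head.
  have [N [fN NI KN LN]] := fg_directed fI fK KI fL LI.
  exists N; split => // z /=; rewrite inE => /orP[/eqP ->|/sK].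
    exact: v_closure_mono Ly.
  exact: v_closure_mono.
exists K => //; apply: v_closure_idem; apply: v_closure_mono Jx.
by apply: gen_sub => //; exact: submod_v.
Qed.

Lemma t_ideal_t I : frac_ideal I -> t_ideal (t_closure I).
Proof. by move=> fI; split; [exact: frac_ideal_t|exact: t_closure_idem]. Qed.

Lemma prod_ideal_sub A B M : submod M ->
  (forall a b, A a -> B b -> M (a * b)) -> prod_ideal A B `<=` M.
Proof. by move=> mM h; apply: gen_sub => // _ [a Aa [b Bb <-]]; exact: h. Qed.

Lemma mem_prod A B a b : A a -> B b -> prod_ideal A B (a * b).
Proof. by move=> Aa Bb; apply: sub_gen; exists a => //; exists b. Qed.

Lemma submod_mulr M c : submod M -> submod [set x | M (x * c)].
Proof.
move=> [M0 MD MZ]; split => /=; first by rewrite mul0r.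
  by move=> x y hx hy; rewrite mulrDl; exact: MD.
by move=> r x hx; rewrite -mulrA; exact: MZ.
Qed.

Lemma frac_ideal_prod A B :
  frac_ideal A -> frac_ideal B -> frac_ideal (prod_ideal A B).
Proof.
move=> [mA [a Aa a0] [d d0 dA]] [mB [b Bb b0] [e e0 eB]]; split.
- exact: submod_gen.
- by exists (a * b); [exact: mem_prod|rewrite mulf_neq0].
- exists (d * e); first by rewrite mulf_neq0.
  suff: prod_ideal A B `<=` [set x | ring_set (x * (d * e)%:F)].
    by move=> h x /h /=; rewrite mulrC.
  apply: prod_ideal_sub; first exact/submod_mulr/submod_ring.
  move=> x y /dA[r _ rE] /eB[s _ sE]; exists (r * s) => //.
  by rewrite !rmorphM /= rE sE mulrACA mulrC.
Qed.

Lemma prod_idealC A B : prod_ideal A B = prod_ideal B A.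
Proof.
apply/seteqP; split; apply: prod_ideal_sub; try exact: submod_gen;
  by move=> a b ha hb; rewrite mulrC; exact: mem_prod.
Qed.

Lemma prod_idealA A B C :
  prod_ideal A (prod_ideal B C) = prod_ideal (prod_ideal A B) C.
Proof.
have sub A' B' C' : prod_ideal (prod_ideal A' B') C' `<=`
    prod_ideal A' (prod_ideal B' C').
  apply: prod_ideal_sub; first exact: submod_gen.
  move=> x c hx Cc; move: x hx.
  apply: (@prod_ideal_sub _ _ [set x | prod_ideal A' (prod_ideal B' C') (x * c)]).
    exact/submod_mulr/submod_gen.
  move=> a b Aa Bb /=; rewrite -mulrA; apply: mem_prod => //.
  exact: mem_prod.
apply/seteqP; split => //.
rewrite prod_idealC [prod_ideal B C]prod_idealC.
by rewrite [X in _ `<=` X]prod_idealC [prod_ideal A B]prod_idealC.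
Qed.

Lemma prod_ideal_mono A B C : A `<=` B -> prod_ideal A C `<=` prod_ideal B C.
Proof.
move=> AB; apply: prod_ideal_sub; first exact: submod_gen.
by move=> a c /AB; exact: mem_prod.
Qed.

Lemma submod_scale c A : submod A -> submod (scale c A).
Proof.
move=> [A0 AD AZ]; split; first by exists 0; rewrite // mulr0.
  move=> _ _ [x Ax <-] [y Ay <-].
  by exists (x + y); rewrite ?mulrDr//; exact: AD.
by move=> r _ [x Ax <-]; exists (r%:F * x); [exact: AZ|rewrite mulrCA].
Qed.

Lemma scaleM c e A : scale c (scale e A) = scale (c * e) A.
Proof.
apply/seteqP; split.
  by move=> _ [_ [x Ax <-] <-]; exists x; rewrite // mulrA.
by move=> _ [x Ax <-]; exists (e * x); [exists x|rewrite mulrA].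
Qed.

Lemma scale1 A : scale 1 A = A.
Proof. by rewrite /scale; under eq_imagel do rewrite mul1r; rewrite image_id. Qed.

Lemma scaleK c A : c != 0 -> scale c^-1 (scale c A) = A.
Proof. by move=> c0; rewrite scaleM mulVf// scale1. Qed.

Lemma scale_mono c A B : A `<=` B -> scale c A `<=` scale c B.
Proof. by move=> AB _ [x /AB Bx <-]; exists x. Qed.

Lemma gen_scale c X : c != 0 -> gen (scale c X) = scale c (gen X).
Proof.
move=> c0; have sub e Y : gen (scale e Y) `<=` scale e (gen Y).
  apply: gen_sub; first exact/submod_scale/submod_gen.
  by apply: scale_mono; exact: sub_gen.
apply/seteqP; split => //.
have := sub c^-1 (scale c X); rewrite scaleK// => /(@scale_mono c).
by rewrite scaleM mulfV// scale1.
Qed.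

Lemma frac_ideal_scale c A : c != 0 -> frac_ideal A -> frac_ideal (scale c A).
Proof.
move=> c0 [mA [a Aa a0] [d d0 dA]]; split; first exact: submod_scale.
  by exists (c * a); [exists a|rewrite mulf_neq0].
have [n [m [m0 cE]]] : exists n m : R, m != 0 /\ m%:F * c = n%:F.
  move: c {c0}; elim/quotW => q; exists (frac q).1, (frac q).2.
  split; first exact: denom_ratioP.
  rewrite /FracField.tofrac; unlock.
  rewrite -[_ * _]/(FracField.mul _ _) -FracField.pi_mul; apply/eqmodP => /=.
  by rewrite FracField.equivfE /FracField.mulf !numden_Ratio
    ?mul1r ?mulr1 ?mulf_neq0 ?oner_eq0 ?denom_ratioP // mulrC.
exists (m * d); first by rewrite mulf_neq0.
move=> _ [x /dA[r _ rE] <-]; exists (n * r) => //.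
by rewrite !rmorphM /= -cE rE mulrACA.
Qed.

Lemma t_closure_scale c A : c != 0 ->
  t_closure (scale c A) = scale c (t_closure A).
Proof.
move=> c0; have sub e B : e != 0 ->
    scale e (t_closure B) `<=` t_closure (scale e B).
  move=> e0 _ [x [J [[fJ [X fX JE]] JB] Jx] <-].
  exists (scale e J); last by apply: v_closure_scale; exists x.
  split; last exact: scale_mono.
  split; first exact: frac_ideal_scale.
  by exists (scale e X); [exact: finite_image|rewrite JE gen_scale].
apply/seteqP; split; last exact: sub.
have := sub c^-1 (scale c A) (invr_neq0 c0).
by rewrite scaleK// => /(@scale_mono c); rewrite scaleM mulfV// scale1.
Qed.

Lemma prod_ideal_scale c A B :
  c != 0 -> prod_ideal (scale c A) B = scale c (prod_ideal A B).
Proof.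
move=> c0; rewrite /prod_ideal -gen_scale//; congr gen; apply/seteqP; split.
  move=> _ [_ [a Aa <-] [b Bb <-]]; exists (a * b); last by rewrite mulrA.
  by exists a => //; exists b.
move=> _ [_ [a Aa [b Bb <-]] <-]; exists (c * a); first by exists a.
by exists b => //; rewrite mulrA.
Qed.

Lemma t_closure_prodl A B : frac_ideal A -> frac_ideal B ->
  t_closure (prod_ideal (t_closure A) B) = t_closure (prod_ideal A B).
Proof.
move=> fA fB; have fAB := frac_ideal_prod fA fB.
apply/seteqP; split; last first.
  by apply: t_closure_mono; apply: prod_ideal_mono; exact: t_closure_sub.
rewrite -[X in _ `<=` X]t_closure_idem//; apply: t_closure_mono.
apply: prod_ideal_sub; first by case: (frac_ideal_t fAB).
move=> x b Ax Bb; have [->|b0] := eqVneq b 0.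
  by rewrite mulr0; case: (frac_ideal_t fAB) => -[].
have : scale b (t_closure A) (x * b) by exists x; rewrite // mulrC.
rewrite -t_closure_scale//; apply: t_closure_mono => _ [a Aa <-].
by rewrite mulrC; exact: mem_prod.
Qed.

Lemma t_prodA A B C : frac_ideal A -> frac_ideal B -> frac_ideal C ->
  t_closure (prod_ideal A (t_closure (prod_ideal B C))) =
  t_closure (prod_ideal (t_closure (prod_ideal A B)) C).
Proof.
move=> fA fB fC.
have fAB := frac_ideal_prod fA fB; have fBC := frac_ideal_prod fB fC.
by rewrite prod_idealC !t_closure_prodl// prod_idealC prod_idealA.
Qed.

End Theory.

(** * The t-class semigroup *)

(* The carrier [tclass R] is the quotient of the semigroup of t-ideals under
   (I, J) |-> (IJ)_t by the congruence [same_class]; [pi_tmul] says that its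
   product is induced by the t-multiplication. *)
Record tideal (R : idomainType) :=
  TIdeal { tideal_set : set {fraction R}; _ : `[< t_ideal tideal_set >] }.

HB.instance Definition _ (R : idomainType) :=
  [isSub for @tideal_set R].
HB.instance Definition _ (R : idomainType) := [Choice of tideal R by <:].

Section TClass.
Context (R : idomainType).
Implicit Types I J K : tideal R.

Lemma tidealP I : t_ideal (val I). Proof. by case: I => I /= /asboolP. Qed.

Definition tmul I J : tideal R :=
  TIdeal (introT (asboolP _)
    (t_ideal_t (frac_ideal_prod (tidealP I).1 (tidealP J).1))).

Lemma tmulA : associative tmul.
Proof.
by move=> I J K; apply/val_inj/t_prodA; [case: (tidealP I)|case: (tidealP J)|case: (tidealP K)].
Qed.

Lemma tmulC : commutative tmul.
Proof. by move=> I J; apply: val_inj; rewrite /= prod_idealC. Qed.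

Definition same_class : rel (tideal R) :=
  fun I J => `[< exists2 c : {fraction R}, c != 0 & val J = scale c (val I) >].

Lemma same_class_refl : reflexive same_class.
Proof. by move=> I; apply/asboolP; exists 1; rewrite ?oner_eq0// scale1. Qed.

Lemma same_class_sym : symmetric same_class.
Proof.
have sub I J : same_class I J -> same_class J I.
  move=> /asboolP[c c0 JE]; apply/asboolP; exists c^-1; first exact: invr_neq0.
  by rewrite JE scaleK.
by move=> I J; apply/idP/idP; exact: sub.
Qed.

Lemma same_class_trans : transitive same_class.
Proof.
move=> J I K /asboolP[c c0 JE] /asboolP[e e0 KE]; apply/asboolP.
by exists (e * c); [rewrite mulf_neq0|rewrite KE JE scaleM].
Qed.

Canonical same_class_equiv :=
  EquivRel same_class same_class_refl same_class_sym same_class_trans.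

Definition tclass := {eq_quot same_class}.
HB.instance Definition _ : EqQuotient _ same_class tclass :=
  EqQuotient.on tclass.
HB.instance Definition _ := Choice.on tclass.

Definition tclass_mul : tclass -> tclass -> tclass := lift_op2 tclass tmul.

Lemma pi_tmul : {morph \pi_tclass : I J / tmul I J >-> tclass_mul I J}.
Proof.
have subl I J K : same_class I J -> same_class (tmul I K) (tmul J K).
  move=> /asboolP[c c0 JE]; apply/asboolP; exists c => //=.
  by rewrite JE prod_ideal_scale// t_closure_scale.
move=> I J; unlock tclass_mul; apply/eqmodP => /=.
apply: (@same_class_trans (tmul (repr (\pi_tclass I)) J)).
  by apply: subl; rewrite same_class_sym; apply/eqmodP; rewrite reprK.
rewrite tmulC [X in same_class _ X]tmulC.
by apply: subl; rewrite same_class_sym; apply/eqmodP; rewrite reprK.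
Qed.
Canonical pi_tmul_morph := PiMorph2 pi_tmul.

Lemma tclass_mulA : associative tclass_mul.
Proof.
elim/quotW => I; elim/quotW => J; elim/quotW => K.
by rewrite -!pi_tmul tmulA.
Qed.

HB.instance Definition _ := isSemigroup.Build tclass tclass_mulA.

End TClass.

Definition boolean_semigroup (S : semigroupType) : Prop :=
  forall x : S, x = (x * x)%g.

Definition boole_t_regular (R : idomainType) : Prop :=
  boolean_semigroup (tclass R).

(* Main.v *)
(** (1) => (2): an equality I = a (I : I) gives (I I)_t = a I, hence the Boole
    property.  If 0 <> P < Q are primes with Q = a T, T = (Q : Q), then P is an
    ideal of T; for 0 <> y in P the ideals I_m = y^m T[1/a] /\ T satisfy, by
    finiteness of T/aT = T/Q over R/Q and Nakayama, u I_m <= I_(m+1) for some u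
    outside Q, whence a^n u is in yT <= P: a contradiction.

    (2) => (1): if (I I)_t = c I, then J = I/c satisfies (J J)_t = J, and
    T = (J : J) satisfies (T : J) = T; it remains to see that 1 is in J.
    Otherwise some t-prime Q contains J /\ R, and Q has height one as t-dim R = 1.
    For 0 <> x in J /\ R there is then a prime N = (xT :_T z) of T, z not in xT,
    disjoint from (R \ Q) + J; it contains Q, hence J by finiteness of T/N
    over R/Q.  So z/x is in (T : J) = T, a contradiction. *)
Require Import Defs.
From mathcomp Require Import all_boot all_order all_algebra.
From mathcomp Require Import boolp classical_sets cardinality.
From mathcomp Require Import ring.
Local Open Scope ring_scope.

Set Implicit Arguments.
Unset Strict Implicit.
Unset Printing Implicit Defensive.
Import GRing.Theory.
Local Open Scope classical_set_scope.

(** * Submodules of the quotient field, compared up to multipliers outside a prime *)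

Section Submodules.
Context (R : idomainType).
Local Notation F := {fraction R}.
Implicit Types (A B I J M N T X : set F) (P Q : set R) (s : seq F).

Lemma submodB M x y : submod M -> M x -> M y -> M (x - y).
Proof.
move=> [_ MD MZ] Mx My; apply: MD => //.
by have := MZ (-1) _ My; rewrite rmorphN1 mulN1r.
Qed.

Lemma submod_setI A B : submod A -> submod B -> submod (A `&` B).
Proof.
move=> [A0 AD AZ] [B0 BD BZ]; split; first by [].
  by move=> x y [Ax Bx] [Ay By]; split; [exact: AD|exact: BD].
by move=> r x [Ax Bx]; split; [exact: AZ|exact: BZ].
Qed.

Definition adjoin (x : F) B : set F :=
  [set z | exists r : R, exists2 b, B b & z = r%:F * x + b].

Definition span B s : set F := foldr adjoin B s.

Lemma submod_adjoin x B : submod B -> submod (adjoin x B).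
Proof.
move=> [B0 BD BZ]; split.
- by exists 0, 0; rewrite // rmorph0 mul0r addr0.
- move=> _ _ [r [b Bb ->]] [r' [b' Bb' ->]]; exists (r + r'), (b + b').
    exact: BD.
  by rewrite rmorphD mulrDl addrACA.
- move=> t _ [r [b Bb ->]]; exists (t * r), (t%:F * b); first exact: BZ.
  by rewrite rmorphM mulrDr mulrA.
Qed.

Lemma sub_adjoin x B : B `<=` adjoin x B.
Proof. by move=> b Bb; exists 0, b; rewrite // rmorph0 mul0r add0r. Qed.

Lemma adjoin_mem x B : B 0 -> adjoin x B x.
Proof. by move=> B0; exists 1, 0; rewrite // rmorph1 mul1r addr0. Qed.

Lemma submod_span B s : submod B -> submod (span B s).
Proof. by move=> mB; elim: s => //= x s IH; exact: submod_adjoin. Qed.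

Lemma sub_span B s : B `<=` span B s.
Proof. by elim: s => //= x s IH b /IH; exact: sub_adjoin. Qed.

Lemma span_mem B s x : submod B -> x \in s -> span B s x.
Proof.
move=> mB; elim: s => //= y s IH; rewrite inE => /orP[/eqP ->|/IH].
  by apply: adjoin_mem; case: (submod_span s mB).
exact: sub_adjoin.
Qed.

Lemma gen_sub_span B s : submod B -> gen [set` s] `<=` span B s.
Proof.
move=> mB; apply: gen_sub; first exact: submod_span.
by move=> x /= xs; exact: span_mem.
Qed.

(** This is what localizing at [Q] requires; below, multiplication by some [u] outside [Q] stands in
    for passing to the localization. *)
Definition compl_mul Q := ~ Q 1 /\ forall u v, ~ Q u -> ~ Q v -> ~ Q (u * v).

(* (span B s)/B is a module of finite length once localized at Q; the sequence
   of submodules is decreasing. *)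
Lemma saturated_dcc Q B s (M : nat -> set F) :
    compl_mul Q -> submod B ->
    (forall q x, Q q -> x \in s -> B (q%:F * x)) ->
    (forall n, submod (M n)) -> (forall m n, (m <= n)%N -> M n `<=` M m) ->
    (forall n, B `<=` M n) -> M 0%N `<=` span B s ->
  exists m, forall n, (m <= n)%N -> forall x, M m x ->
    exists2 u, ~ Q u & M n (u%:F * x).
Proof.
move=> [Q1 QM] mB; elim: s M => [|x s IH] M Qs mM Mdec BM Ms.
  exists 0%N => n _ y /Ms By; exists 1 => //.
  by rewrite rmorph1 mul1r; exact: BM.
have {Qs}[Qx Qs] : (forall q, Q q -> B (q%:F * x)) /\
    forall q y, Q q -> y \in s -> B (q%:F * y).
  by split => [q Qq|q y Qq ys]; apply: Qs; rewrite // inE ?eqxx ?ys ?orbT.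
have mS := submod_span s mB.
(* Either from some stage on all coefficients of [x] lie in [Q], so that the chain enters
   [span B s], or every stage has an element with a coefficient of [x] outside [Q]. *)
have [[m2 M2]|/forallNP H] := pselect (exists m, forall r b, span B s b ->
    M m (r%:F * x + b) -> Q r).
  have [|||||m Hm] := IH (fun n => M (m2 + n)%N) => //.
  - by move=> i j ij; apply: Mdec; rewrite leq_add2l.
  - rewrite addn0 => z Mz; have [r [b sb zE]] := Ms _ (Mdec _ _ (leq0n _) _ Mz).
    rewrite zE; case: mS => _ SD _; apply: SD => //.
    apply: sub_span; apply: Qx; apply: (M2 _ b) => //.
    by rewrite -zE.
  - exists (m2 + m)%N => n mn z /Hm.
    have m2n : (m2 <= n)%N by rewrite (leq_trans _ mn)// leq_addr.
    move=> /(_ (n - m2)%N); rewrite subnKC//; apply.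
    by rewrite leq_subRL.
have [|||||m Hm] := IH (fun n => M n `&` span B s) => //.
- by move=> n; exact: submod_setI.
- by move=> i j ij z [/(Mdec _ _ ij)].
- by move=> n b Bb; split; [exact: BM|exact: sub_span].
exists m => n mn z Mz.
have [c [b sb zE]] := Ms _ (Mdec _ _ (leq0n _) _ Mz).
have /existsNP[r /existsNP[b' /not_implyP[sb' /not_implyP[Mb' Qr]]]] := H n.
(* The combination eliminates [x]. As [r%:F * x + b'] was taken in [M n], its multiple can be added
   back there, at the cost of the factor [r] outside [Q]. *)
have [|u Qu [Mu _]] := Hm n mn (r%:F * z - c%:F * (r%:F * x + b')).
  case: (mM m) => _ MD MZ; case: (mS) => _ SD SZ; split.
    by apply: submodB => //; apply: MZ => //; exact: Mdec Mb'.
  rewrite (_ : _ - _ = r%:F * b - c%:F * b'); last by rewrite zE; ring.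
  by apply: submodB => //; exact: SZ.
exists (u * r); first exact: QM.
case: (mM n) => _ MD MZ.
rewrite (_ : _ * z = u%:F * (r%:F * z - c%:F * (r%:F * x + b'))
   + (u * c)%:F * (r%:F * x + b')); last by rewrite !rmorphM; ring.
by apply: MD => //; exact: MZ.
Qed.

(* Nakayama's lemma localized at Q for (span N s)/N, where a lies in Q. *)
Lemma saturated_nakayama Q a N s : compl_mul Q ->
    (forall u r, ~ Q u -> ~ Q (u - a * r)) -> submod N ->
    (forall x, x \in s -> exists u, [/\ ~ Q u & exists2 v, span N s v &
       N (u%:F * x - a%:F * v)]) ->
  exists2 u, ~ Q u & forall x, span N s x -> N (u%:F * x).
Proof.
move=> [Q1 QM] Qa mN; have [_ ND NZ] := mN; elim: s => [_|x s IH H].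
  by exists 1 => // x Nx; rewrite rmorph1 mul1r.
have [u0 [Qu0 [_ [r [v sv ->]] Nv]]] := H x (mem_head _ _).
(* The [x]-term of the error is moved to the left: the new multiplier still avoids [Q], and the
   remaining [v] lies in [span N s]. *)
set u := u0 - a * r.
have Qu : ~ Q u by exact: Qa.
have {}Nv : N (u%:F * x - a%:F * v).
  by rewrite (_ : _ - _ = u0%:F * x - a%:F * (r%:F * x + v))//
    rmorphB rmorphM; ring.
have [_ SD SZ] := submod_span s mN.
have [|w Qw Nw] := IH.
  move=> y ys; have [|w [Qw [_ [t [z sz ->]] Nz]]] := H y.
    by rewrite inE ys orbT.
  exists (u * w); split; first exact: QM.
  exists ((a * t)%:F * v + u%:F * z); first by apply: SD; exact: SZ.
  rewrite (_ : _ - _ = u%:F * (w%:F * y - a%:F * (t%:F * x + z))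
    + (a * t)%:F * (u%:F * x - a%:F * v)); last by rewrite !rmorphM; ring.
  by apply: ND; exact: NZ.
exists (w * u); first exact: QM.
move=> _ [t [z sz ->]].
rewrite (_ : _ * _ = (t * w)%:F * (u%:F * x - a%:F * v)
  + (t * a)%:F * (w%:F * v) + u%:F * (w%:F * z)); last by rewrite !rmorphM; ring.
by apply: (ND); [apply: (ND)|]; apply: NZ => //; exact: Nw.
Qed.

(** * Maximal submodules and prime conductors over a Noetherian domain *)

Definition bounded_by (d : F) M := forall x, M x -> ring_set (d * x).

Hypothesis noethR : noetherian R.

(** Multiplication by [d] identifies [M] with an ideal of [R], whose finitely many generators are
    then divided by [d]. *)
Lemma bounded_fg M d : submod M -> d != 0 -> bounded_by d M ->
  exists s, M = gen [set` s].
Proof.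
move=> mM d0 Md; have [M0 MD MZ] := mM.
have [|X fX XE] := noethR (I := [set r | M (r%:F / d)]).
  split => [|x y Mx My|r x Mx] /=; first by rewrite rmorph0 mul0r.
    by rewrite rmorphD mulrDl; exact: MD.
  by rewrite rmorphM -mulrA; exact: MZ.
have /finite_seqP[s sE] := finite_image (fun r => r%:F / d) fX.
exists s; rewrite -sE; apply/seteqP; split; last first.
  apply: gen_sub => // _ [r Xr <-].
  suff : [set r | M (r%:F / d)] r by [].
  by rewrite XE; exact: sub_gen_smallest.
have [G0 GD GZ] := submod_gen [set r%:F / d | r in X].
move=> x Mx; have [r _ rE] := Md _ Mx.
have xE : x = r%:F / d by rewrite rE mulrAC mulfV// mul1r.
have : [set r | M (r%:F / d)] r by rewrite /= -xE.
rewrite XE xE => /(_ [set r | gen [set r%:F / d | r in X] (r%:F / d)]); apply.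
split; last by move=> t Xt; apply: sub_gen; exists t.
split => [|y z Gy Gz|t y Gy] /=; first by rewrite rmorph0 mul0r.
  by rewrite rmorphD mulrDl; exact: GD.
by rewrite rmorphM -mulrA; exact: GZ.
Qed.

(** Without a maximal member, choice builds a strictly increasing chain. Its union is still bounded
    by [d], hence finitely generated, and the generators already occur at a finite stage. *)
Lemma submod_max (C : set (set F)) M0 d : d != 0 -> C M0 ->
    (forall M, C M -> submod M /\ bounded_by d M) ->
  exists2 M, C M & forall N, C N -> M `<=` N -> N `<=` M.
Proof.
move=> d0 CM0 HC; apply: contrapT => noM.
have /choice[f fP] : forall M, exists N,
    C M -> [/\ C N, M `<=` N & ~ N `<=` M].
  move=> M; have [CM|nCM] := pselect (C M); last by exists M.
  apply: contrapT => /forallNP H; apply: noM; exists M => // N CN MN.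
  by apply: contrapT => NM; apply: (H N).
pose g n := iter n f M0.
have Cg n : C (g n) by elim: n => //= n /fP[].
have gS n : g n `<=` g n.+1 by have [] := fP _ (Cg n).
have gle m n : (m <= n)%N -> g m `<=` g n.
  move=> mn; rewrite -(subnKC mn); elim: (n - m)%N => [|k IH].
    by rewrite addn0.
  by rewrite addnS; apply: subset_trans IH (gS _).
have mg n : submod (g n) by have [] := HC _ (Cg n).
have [||s sE] := @bounded_fg (\bigcup_n g n) d _ d0.
- split; first by exists 0%N => //; case: (mg 0%N).
    move=> x y [m _ gx] [n _ gy]; exists (maxn m n) => //.
    case: (mg (maxn m n)) => _ GD _; apply: GD.
      by apply: gle gx; rewrite leq_maxl.
    by apply: gle gy; rewrite leq_maxr.
  by move=> r x [n _ gx]; exists n => //; case: (mg n) => _ _; apply.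
- by move=> x [n _ gx]; have [_] := HC _ (Cg n); apply.
have [m sm] : exists m, [set` s] `<=` g m.
  have : [set` s] `<=` \bigcup_n g n by rewrite sE; exact: sub_gen.
  elim: s {sE} => [_|x s IH xs]; first by exists 0%N.
  have [|m sm] := IH; first by move=> y ys; apply: xs; rewrite /= inE ys orbT.
  have [|n _ gx] := xs x; first by rewrite /= mem_head.
  exists (maxn m n) => y /=; rewrite inE => /orP[/eqP ->|/sm].
    by apply: gle gx; rewrite leq_maxr.
  by apply: gle; rewrite leq_maxl.
have [_ _] := fP _ (Cg m); apply => x gx.
have : (\bigcup_n g n) x by exists m.+1.
by rewrite sE; apply: gen_sub.
Qed.

(* A prime annihilator: the conductors (I :_T y) with S y disjoint from I have
   a maximal element. *)
Lemma prime_conductor T I (S : set F) (y0 d : F) :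
    submod T -> d != 0 -> bounded_by d T ->
    (forall x y, T x -> T y -> T (x * y)) -> submod I ->
    S 1 -> (forall x y, S x -> S y -> S (x * y)) -> S `<=` T ->
    (forall t x, T t -> I x -> I (t * x)) ->
    (forall x, S x -> ~ I (x * y0)) ->
  exists y, [/\ exists2 t, T t & y = t * y0, forall x, S x -> ~ I (x * y) &
    forall t u, T t -> T u -> I (t * u * y) -> I (t * y) \/ I (u * y)].
Proof.
move=> mT d0 Td TM mI S1 SM ST IT Sy0.
pose good y := (exists2 t, T t & y = t * y0) /\ forall x, S x -> ~ I (x * y).
pose N y := T `&` [set t | I (t * y)].
have good0 : good y0.
  by split=> //; exists 1; rewrite ?mul1r//; exact: ST.
have goodT y t : good y -> T t -> (forall x, S x -> ~ I (x * (t * y))) ->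
    good (t * y).
  by move=> [[u Tu ->] _] Tt H; split=> //; exists (t * u);
    [exact: TM|rewrite mulrA].
have [||_ [y gy <-] ymax] := @submod_max (N @` good) (N y0) d d0.
- by exists y0.
- move=> _ [y gy <-]; split; last by move=> x [/Td].
  exact/submod_setI/submod_mulr.
(* Passing from [y] to [t * y] enlarges the conductor, so maximality forces equality as long as
   [t * y] is good. *)
have Nmax t u : T t -> T u -> (forall x, S x -> ~ I (x * (t * y))) ->
    I (u * (t * y)) -> I (u * y).
  move=> Tt Tu H Iuty; suff: N y u by case.
  apply: (ymax (N (t * y))) => //; first by exists (t * y) => //; exact: goodT.
  by move=> x [Tx /= Ix]; split=> //=; rewrite mulrCA; exact: IT.
have [y0y Sy] := gy.
exists y; split=> // t u Tt Tu Itu.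
(* If some [x] in [S] sends [u * y] into [I], then [x * y] is good and has the conductor of [y];
   otherwise [u * y] itself is good. *)
have [[x Sx Ix]|H] := pselect (exists2 x, S x & I (x * (u * y))).
  right; apply: (Nmax x) => //; first exact: ST.
    by move=> z Sz; rewrite mulrA; apply/Sy/SM.
  by rewrite mulrCA.
left; apply: (Nmax u) => //; last by rewrite mulrA.
by move=> x Sx Ix; apply: H; exists x.
Qed.

End Submodules.

(** * Prime t-ideals obtained as conductors *)

Section TPrimes.
Context (R : idomainType).
Local Notation F := {fraction R}.
Local Notation iota := (@FracField.tofrac R).
Implicit Types (A B I J M N T X : set F) (P Q : set R) (s : seq F).

Definition prime_ideal P :=
  [/\ ideal P, ~ P 1 & forall u v, P (u * v) -> P u \/ P v].

Lemma t_primeP P : t_prime P <-> prime_ideal P /\ t_ideal (iota @` P).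
Proof.
split=> [[[P0 P1 PL] PM tP]|[[[P0 PD PZ] P1 PM] tP]]; split=> //; first split.
- split=> [|x y Px Py|r x Px]; first exact/set_mem.
    by rewrite -[x]mul1r; apply/set_mem/PL; exact/mem_set.
  rewrite -[r * x]addr0; apply/set_mem/PL => //; exact/mem_set.
- by move=> P1'; move/negP: P1; apply; exact/mem_set.
- move=> u v Puv; have /PM/orP[] : u * v \in mem P by exact/mem_set.
    by move=> /set_mem; left.
  by move=> /set_mem; right.
- split; first exact/mem_set.
    by apply/negP => /set_mem.
  by move=> r u v /set_mem Pu /set_mem Pv; apply/mem_set/PD => //; exact: PZ.
- by move=> u v /set_mem/PM[] h; apply/orP; [left|right]; exact/mem_set.
Qed.

Lemma frac_ideal_ring : frac_ideal (@ring_set R).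
Proof.
split; first exact: submod_ring.
  by exists 1; [exists 1; rewrite ?rmorph1|exact: oner_neq0].
by exists 1; [exact: oner_neq0|move=> x; rewrite rmorph1 mul1r].
Qed.

Lemma t_closure_sub_ring I : I `<=` @ring_set R -> t_closure I `<=` @ring_set R.
Proof.
move=> IR x [J [_ JI] Jx]; rewrite -[x]mulr1; apply: Jx => y Jy.
by rewrite mul1r; exact/IR/JI.
Qed.

Lemma t_ideal_ring : t_ideal (@ring_set R).
Proof.
split; first exact: frac_ideal_ring.
apply/seteqP; split; first exact: t_closure_sub_ring.
by apply: t_closure_sub; exact: frac_ideal_ring.
Qed.

Lemma t_ideal_scale c I : c != 0 -> t_ideal I -> t_ideal (scale c I).
Proof.
move=> c0 [fI tI]; split; first exact: frac_ideal_scale.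
by rewrite t_closure_scale// tI.
Qed.

Lemma denominator (c : F) : c != 0 ->
  exists2 d : R, d != 0 & ring_set (d%:F * c).
Proof.
move=> c0; have [_ _ [d d0 dc]] := frac_ideal_scale c0 frac_ideal_ring.
exists d => //; apply: dc; exists 1; rewrite ?mulr1//.
by exists 1; rewrite ?rmorph1.
Qed.

Lemma t_ideal_setI I J : frac_ideal (I `&` J) -> t_ideal I -> t_ideal J ->
  t_ideal (I `&` J).
Proof.
move=> fIJ [_ tI] [_ tJ]; split=> //.
apply/seteqP; split; last exact: t_closure_sub.
by move=> x xIJ; split; [rewrite -tI|rewrite -tJ];
  apply: t_closure_mono xIJ; [exact: subIsetl|exact: subIsetr].
Qed.

(** Supplies the t-primes constructed below. The prime is the intersection of [R] with a scaled copy
    of [I], and a fractional ideal that is an intersection of two t-ideals is a t-ideal. *)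
Lemma t_prime_conductor I (S : set R) (y0 : F) :
    noetherian R -> t_ideal I -> S 1 -> (forall u v, S u -> S v -> S (u * v)) ->
    (forall u, S u -> ~ I (u%:F * y0)) ->
  exists P, [/\ t_prime P, forall u, S u -> ~ P u &
    forall r, I (r%:F * y0) -> P r].
Proof.
move=> noethR tI S1 SM Sy0; have [[mI [x Ix x0] _] _] := tI.
have [I0 ID IZ] := mI.
have [||||||||y [[_ [c _ <-] yE] Sy PM]] :=
  @prime_conductor _ noethR (@ring_set R) I (iota @` S) y0 1 (@submod_ring R)
    (oner_neq0 _) => //.
- by move=> z; rewrite mul1r.
- by move=> _ _ [u _ <-] [v _ <-]; exists (u * v); rewrite ?rmorphM.
- by exists 1; rewrite ?rmorph1.
- by move=> _ _ [u Su <-] [v Sv <-]; exists (u * v); rewrite ?rmorphM//; exact: SM.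
- by move=> _ [u _ <-]; exists u.
- by move=> _ z [u _ <-]; exact: IZ.
- by move=> _ [u Su <-]; exact: Sy0.
have y_neq0 : y != 0.
  by apply: contra_not_neq (Sy 1 _) => [->|]; rewrite ?mulr0//;
    exists 1; rewrite ?rmorph1.
pose P := [set r : R | I (r%:F * y)].
have PE : iota @` P = @ring_set R `&` scale y^-1 I.
  apply/seteqP; split.
    move=> _ [r Pr <-]; split; first by exists r.
    by exists (r%:F * y); rewrite // mulrCA mulVf// mulr1.
  by move=> _ [[r _ <-] [z Iz rE]]; exists r => //;
    rewrite /P /= -rE mulrAC mulVf// mul1r.
exists P; split; last 2 first.
- by move=> u Su; apply: Sy; exists u.
- by move=> r; rewrite /P /= yE mulrCA; exact: IZ.
apply/t_primeP; split; first split.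
- split=> [|u v|r u]; rewrite /P /= ?rmorph0 ?mul0r//.
    by rewrite rmorphD mulrDl; exact: ID.
  by rewrite rmorphM -mulrA; exact: IZ.
- by rewrite /P /=; apply: Sy; exists 1.
- by move=> u v; rewrite /P /= rmorphM => Puv; apply: PM; [exists u|exists v|].
rewrite PE; apply: t_ideal_setI; [|exact: t_ideal_ring|]; last first.
  by apply: t_ideal_scale; rewrite ?invr_neq0.
(* The nonzero element of [P] is [d x / y]: it lies in [R] by the choice of [d], and [d x] lies in
   [I]. *)
have xy0 : x / y != 0 by rewrite mulf_neq0 ?invr_neq0.
have [d d0 dxy] := denominator xy0.
have d0' : d%:F != 0 by rewrite tofrac_eq0.
split.
- by apply: submod_setI; [exact: submod_ring|exact: submod_scale].
- exists (d%:F * (x / y)); last exact: mulf_neq0.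
  split=> //; exists (d%:F * x); first exact: IZ.
  by rewrite mulrC mulrA.
- exists 1; first exact: oner_neq0.
  by move=> z [Rz _]; rewrite rmorph1 mul1r.
Qed.

(** * Minimality of strongly stable primes among the nonzero primes *)

Lemma strongly_stable_prime_minimal Q P (y : R) :
    noetherian R -> prime_ideal Q -> strongly_stable (iota @` Q) ->
    prime_ideal P -> P `<=` Q -> P y -> y != 0 ->
  Q `<=` P.
Proof.
move=> noethR [[Q0 QD QZ] Q1 QM] [alpha BE] [[P0 PD PZ] P1 PM] PQ Py y0.
apply: contrapT => /existsNP[q0 /not_implyP[Qq0 Pq0]].
set B := iota @` Q in BE; pose T := colon B B.
have mB : submod B.
  split=> [|_ _ [u Qu <-] [v Qv <-]|r _ [u Qu <-]].
  - by exists 0; rewrite ?rmorph0.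
  - by exists (u + v); rewrite ?rmorphD//; exact: QD.
  - by exists (r * u); rewrite ?rmorphM//; exact: QZ.
have mT : submod T by exact: submod_colon.
have [_ TD TZ] := mT.
have TR r : T r%:F.
  by move=> _ [u Qu <-]; exists (r * u); rewrite ?rmorphM//; exact: QZ.
have TM t u : T t -> T u -> T (t * u).
  by move=> Tt Tu b Bb; rewrite -mulrA; apply/Tt/Tu.
have TX t n : T t -> T (t ^+ n).
  move=> Tt; elim: n => [|n IH]; last by rewrite exprS; exact: TM.
  by have := TR 1; rewrite rmorph1.
have [a Qa aE] : B alpha.
  by rewrite BE; exists 1; rewrite ?mulr1//; have := TR 1; rewrite rmorph1.
(* [P] is stable under [T]: the product [(t p) q0 = (t q0) p] lies in [P], while [q0] does not. *)
have PT p t : P p -> T t -> exists2 r, P r & t * p%:F = r%:F.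
  move=> Pp Tt; have [|r Qr rE] := Tt p%:F; first by exists p => //; exact: PQ.
  have [|r' _ r'E] := Tt q0%:F; first by exists q0.
  exists r => //; have : P (r * q0).
    suff -> : r * q0 = r' * p by exact: PZ.
    by apply/eqP; rewrite -tofrac_eq !rmorphM /= rE r'E; apply/eqP; ring.
  by case/PM.
have Pa : ~ P a.
  move=> Pa; have : B q0%:F by exists q0.
  rewrite BE => -[t Tt tE]; have [r Pr rE] := PT _ _ Pa Tt.
  suff rq : r = q0 by rewrite rq in Pr.
  by apply/eqP; rewrite -tofrac_eq -rE -tE -aE mulrC.
have PXa n : ~ P (a ^+ n).
  by elim: n => [|n IH]; [rewrite expr0|rewrite exprS => /PM[]].
(* I m is the a-saturation y^m T[1/a] `&` T of y^m T. *)
pose I m := T `&` [set t | exists n, exists2 u, T u & a%:F ^+ n * t = y%:F ^+ m * u].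
have mI m : submod (I m).
  split.
  - split; first by case: mT.
    by exists 0%N, 0; rewrite ?mulr0//; case: mT.
  - move=> t u [Tt [n [t' Tt' tE]]] [Tu [k [u' Tu' uE]]]; split; first exact: TD.
    exists (n + k)%N, (a%:F ^+ k * t' + a%:F ^+ n * u').
      by apply: TD; apply: TM => //; exact: TX.
    rewrite exprD; transitivity (a%:F ^+ k * (a%:F ^+ n * t) +
      a%:F ^+ n * (a%:F ^+ k * u)); first by ring.
    by rewrite tE uE; ring.
  - move=> r t [Tt [n [t' Tt' tE]]]; split; first exact: TZ.
    by exists n, (r%:F * t'); [exact: TZ|rewrite mulrCA tE mulrCA].
have Idec m n : (m <= n)%N -> I n `<=` I m.
  move=> mn t [Tt [k [u Tu uE]]]; split=> //; exists k, (y%:F ^+ (n - m) * u).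
    by apply: TM => //; exact: TX.
  by rewrite uE mulrA -exprD subnKC.
have y0' : y%:F != 0 by rewrite tofrac_eq0.
have Ty : bounded_by y%:F T.
  move=> t Tt; rewrite mulrC; have [|r _ <-] := Tt y%:F; last by exists r.
  by exists y => //; exact: PQ.
have [s sE] := bounded_fg noethR mT y0' Ty.
(* The chain [I m + B] runs between [B] and [T]. As [T / B] is finitely generated over [R] and
   killed by [Q], it stabilizes up to multipliers. *)
pose M m := [set z | exists2 t, I m t & exists2 b, B b & z = t + b].
have [_ BD BZ] := mB.
have BT : B `<=` T by move=> _ [r _ <-].
have Qc : compl_mul Q by split=> // u v Qu Qv /QM[].
have [|||||m Hm] := @saturated_dcc _ Q B s M Qc mB.
- move=> q x Qq xs; rewrite mulrC; have : T x by rewrite sE; exact: sub_gen.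
  by apply; exists q.
- move=> n; have [I0 ID IZ] := mI n; split.
  + by exists 0 => //; exists 0; rewrite ?addr0//; case: mB.
  + move=> _ _ [t It [b Bb ->]] [t' It' [b' Bb' ->]].
    by exists (t + t'); [exact: ID|exists (b + b'); [exact: BD|rewrite addrACA]].
  + move=> r _ [t It [b Bb ->]].
    by exists (r%:F * t); [exact: IZ|exists (r%:F * b); [exact: BZ|rewrite mulrDr]].
- by move=> k n kn _ [t It [b Bb ->]]; exists t; [exact: Idec It|exists b].
- by move=> n b Bb; exists 0; [case: (mI n)|exists b; rewrite ?add0r].
- move=> _ [t [Tt _] [b Bb ->]]; apply: (gen_sub_span (s := s) mB).
  by rewrite -sE; apply: TD => //; exact: BT.
have [|s' s'E] := bounded_fg noethR (mI m) y0'; first by move=> t [/Ty].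
have [|||u Qu uI] := @saturated_nakayama _ Q a (I m.+1) s' Qc.
- move=> u r Qu Qur; apply: Qu; rewrite -[u](subrK (a * r)).
  by apply: QD => //; rewrite mulrC; exact: QZ.
- exact: mI.
- move=> x xs; have Ix : I m x by rewrite s'E; exact: sub_gen.
  have [|u Qu [w Iw [b Bb uxE]]] := Hm _ (leqnSn m) x.
    by exists x => //; exists 0; rewrite ?addr0//; case: mB.
  exists u; split=> //; move: Bb uxE; rewrite BE => -[t Tt <-] uxE.
  have wE : u%:F * x - a%:F * t = w by rewrite uxE -aE; ring.
  (* From [u x = w + a t] follows that [a t] is in [I m]. Saturation then puts [t] in [I m], so the
     error lies in [a I m], as Nakayama's lemma requires. *)
  exists t; last by rewrite wE.
  apply: (gen_sub_span (s := s') (mI m.+1)); rewrite -s'E; split=> //.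
  have : I m (a%:F * t).
    have [_ _ IZ] := mI m.
    rewrite (_ : _ * t = u%:F * x - w); last by rewrite -wE; ring.
    by apply: submodB (IZ _ _ Ix) _ => //; exact: Idec Iw.
  by case=> _ [n [v Tv vE]]; exists n.+1, v; rewrite // exprSr -mulrA.
(* Membership of [u y^m] in [I (m+1)] reads [a^n u y^m = y^(m+1) t]; cancelling [y^m] gives
   [a^n u = y t], which is in [P]. *)
have [|_ [n [t Tt tE]]] := uI (y%:F ^+ m).
  apply: (gen_sub_span (s := s') (mI m.+1)); rewrite -s'E; split; first exact: TX.
  by exists 0%N, 1; rewrite ?mulr1 ?expr0 ?mul1r//; have := TR 1; rewrite rmorph1.
have [r Pr rE] := PT _ _ Py Tt.
have : P (a ^+ n * u).
  suff -> : a ^+ n * u = r by [].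
  apply/eqP; rewrite -tofrac_eq -rE rmorphM rmorphXn /=.
  apply/eqP/(mulfI (expf_neq0 m y0')).
  by rewrite mulrCA [_ * u%:F]mulrC tE exprS; ring.
by case/PM => [/PXa//|/PQ].
Qed.

(** * Idempotent t-ideals when the t-primes are pairwise incomparable *)

Lemma t_idempotent_mem1 J : noetherian R ->
    (forall P Q, t_prime P -> t_prime Q -> P `<=` Q -> Q `<=` P) ->
    t_ideal J -> t_closure (prod_ideal J J) = J ->
  J 1.
Proof.
move=> noethR dim1 tJ JJ; have [[mJ [x0 Jx0 x00] [e e0 Je]] _] := tJ.
have [J0 JD JZ] := mJ; apply: contrapT => J1.
have JM i j : J i -> J j -> J (i * j).
  move=> Ji Jj; rewrite -JJ; apply: t_closure_sub; last exact: mem_prod.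
  by apply: frac_ideal_prod; case: tJ.
pose T := colon J J.
have mT : submod T by exact: submod_colon.
have [T0 TD TZ] := mT.
have TR r : T r%:F by move=> j; exact: JZ.
have T1 : T 1 by have := TR 1; rewrite rmorph1.
have TM t u : T t -> T u -> T (t * u).
  by move=> Tt Tu j Jj; rewrite -mulrA; apply/Tt/Tu.
have TX t n : T t -> T (t ^+ n).
  by move=> Tt; elim: n => // n IH; rewrite exprS; exact: TM.
have JT : J `<=` T by move=> i Ji j; exact: JM.
(* If [z J] lies in [T], then [z J J] lies in [J]; taking t-closures and using [(J J)_t = J] puts
   [z J] in [J]. *)
have colonTJ z : (forall j, J j -> T (z * j)) -> T z.
  move=> zJ; have [->//|z0] := eqVneq z 0.
  have JJz : scale z (prod_ideal J J) `<=` J.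
    move=> _ [w JJw <-]; rewrite mulrC; move: w JJw.
    apply: (@prod_ideal_sub _ _ _ [set w | J (w * z)]); first exact: submod_mulr.
    by move=> i j Ji Jj /=; rewrite mulrC mulrA; exact: zJ.
  move=> j; rewrite -{1}JJ => JJj; have [_ <-] := tJ.
  by apply: (t_closure_mono JJz); rewrite t_closure_scale//; exists j.
have [||Q [/t_primeP[[[Q0 QD QZ] Q1 QM] tQ] _ JQ]] :=
  t_prime_conductor (S := [set 1]) (y0 := 1) noethR tJ erefl.
- by move=> _ _ -> ->; rewrite mulr1.
- by move=> _ ->; rewrite rmorph1 mulr1.
have {}JQ r : J r%:F -> Q r by move=> Jr; apply: JQ; rewrite mulr1.
have Qprime : t_prime Q by apply/t_primeP.
have [d d0 [x _ xE]] := denominator x00.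
have Jx : J x%:F by rewrite xE; exact: JZ.
have x_neq0 : x%:F != 0 by rewrite xE mulf_neq0// tofrac_eq0.
(* Some power of [q] falls into [xR] localized at [Q]. Otherwise there is a t-prime avoiding all
   [u q^l]; it lies in [Q], hence equals [Q] by [dim1], yet misses [q]. *)
have Qpow q : Q q -> exists l u, ~ Q u /\ exists w, u * q ^+ l = x * w.
  move=> Qq; apply: contrapT => H.
  have [|||P [Pprime SP _]] := @t_prime_conductor (scale x%:F (@ring_set R))
    [set v | exists l, exists2 u, ~ Q u & v = u * q ^+ l] 1 noethR
    (t_ideal_scale x_neq0 t_ideal_ring).
  - by exists 0%N, 1; rewrite ?expr0 ?mulr1.
  - move=> _ _ [l [u Qu ->]] [k [v Qv ->]]; exists (l + k)%N, (u * v).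
      by case/QM.
    by rewrite exprD mulrACA.
  - move=> v [l [u Qu ->]] [_ [w _ <-]]; rewrite mulr1 -rmorphM => /eqP.
    rewrite tofrac_eq => /eqP uE; apply: H; exists l, u; split=> //.
    by exists w; rewrite uE.
  - have PQ : P `<=` Q.
      move=> r Pr; apply: contrapT => Qr; apply: (SP r) => //.
      by exists 0%N, r; rewrite ?expr0 ?mulr1.
    apply: (SP q); last exact: dim1 Qq.
    by exists 1%N, 1; rewrite ?expr1 ?mul1r.
pose S := [set z | exists2 r, ~ Q r & exists2 j, J j & z = r%:F + j].
have SR u : ~ Q u -> S u%:F by move=> Qu; exists u => //; exists 0; rewrite ?addr0.
have S1 : S 1 by have := SR _ Q1; rewrite rmorph1.
have ST : S `<=` T by move=> _ [r _ [j /JT Tj ->]]; exact: TD.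
pose I := scale x%:F T.
have mI : submod I by exact: submod_scale.
have IT t w : T t -> I w -> I (t * w).
  by move=> Tt [v Tv <-]; exists (t * v); [exact: TM|rewrite mulrCA].
have dT : bounded_by (e%:F * x%:F) T.
  by move=> t Tt; rewrite -mulrA; apply: Je; rewrite mulrC; exact: Tt.
have ex0 : e%:F * x%:F != 0 by rewrite mulf_neq0// tofrac_eq0.
have [||z [[z' Tz' zE] Sz PM]] := @prime_conductor _ noethR T I S 1 _ mT ex0 dT TM mI S1 _ ST IT.
- move=> _ _ [r Qr [j Jj ->]] [r' Qr' [j' Jj' ->]]; exists (r * r').
    by case/QM.
  exists (r%:F * j' + r'%:F * j + j * j'); last by rewrite rmorphM; ring.
  by apply: (JD); [apply: (JD); exact: JZ|exact: JM].
(* Since [x T] lies in [J], an element [r + j] of it would put [r] in [J], hence in [Q]. *)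
- move=> _ [r Qr [j Jj ->]]; rewrite mulr1 => -[t Tt tE]; apply: Qr; apply: JQ.
  rewrite (_ : r%:F = t * x%:F - j); last by rewrite [t * _]mulrC tE; ring.
  by apply: submodB => //; exact: Tt.
pose N := T `&` [set t | I (t * z)].
have mN : submod N by exact/submod_setI/submod_mulr.
have Tz : T z by rewrite zE mulr1.
have Nz : ~ I z by have := Sz _ S1; rewrite mul1r.
have Npow t n : T t -> I (t ^+ n * z) -> I (t * z).
  move=> Tt; elim: n => [|n IH]; first by rewrite expr0 mul1r.
  by rewrite exprS => Itz; case: (PM _ _ Tt (TX _ n Tt) Itz).
have QN q : Q q -> I (q%:F * z).
  move=> /Qpow[l [u [Qu [w uE]]]]; apply: (@Npow _ l) => //.
  have uqz : I (u%:F * q%:F ^+ l * z).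
    rewrite -rmorphXn -rmorphM uE rmorphM -mulrA.
    by exists (w%:F * z) => //; exact: TM.
  by case: (PM _ _ (TR u) (TX _ l (TR q)) uqz) => // /(Sz _ (SR _ Qu)).
have [s sE] := bounded_fg noethR mT ex0 dT.
have JN j : J j -> I (j * z).
  move=> Jj; have Tj := JT _ Jj; have [N0 ND NZ] := mN.
  (* [T / N] is finitely generated over [R] and killed by [Q], so the chain [j^m T + N] stabilizes
     up to multipliers outside [Q]. *)
  pose M m := [set w | exists2 t, T t & exists2 b, N b & w = j ^+ m * t + b].
  have [||||||m Hm] := @saturated_dcc _ Q N s M _ mN.
  - by split=> // u v Qu Qv /QM[].
  - move=> q w Qq ws; have Tw : T w by rewrite sE; exact: sub_gen.
    split; first exact: TM.
    by rewrite /= mulrAC mulrC; apply: IT => //; exact: QN.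
  - move=> m; split.
    + by exists 0 => //; exists 0; rewrite ?mulr0 ?addr0.
    + move=> _ _ [t Tt [b Nb ->]] [t' Tt' [b' Nb' ->]].
      exists (t + t'); first exact: TD.
      by exists (b + b'); [exact: ND|rewrite mulrDr addrACA].
    + move=> r _ [t Tt [b Nb ->]]; exists (r%:F * t); first exact: TZ.
      by exists (r%:F * b); [exact: NZ|rewrite mulrDr mulrCA].
  - move=> m n mn _ [t Tt [b Nb ->]]; exists (j ^+ (n - m) * t).
      by apply: TM => //; exact: TX.
    by exists b; rewrite // mulrA -exprD subnKC.
  - by move=> m b Nb; exists 0 => //; exists b; rewrite ?mulr0 ?add0r.
  - move=> _ [t Tt [b [Tb _] ->]]; apply: (gen_sub_span (s := s) mN).
    by rewrite -sE; apply: TD => //; rewrite expr0 mul1r.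
  have [|u Qu [t Tt [b [Tb Ib] uE]]] := Hm _ (leqnSn m) (j ^+ m).
    by exists 1 => //; exists 0; rewrite ?mulr1 ?addr0.
  apply: (@Npow _ m) => //.
  (* The relation [u j^m = j^(m+1) t + b] puts [j^m (u - j t)] in [N]. The second factor lies in
     [S], hence outside [N], so [j^m] is in [N]. *)
  have St : S (u%:F - j * t).
    exists u => //; exists (- (j * t)) => //.
    by rewrite -[- _]add0r; apply: submodB => //; rewrite mulrC; exact: Tt.
  have bE : j ^+ m * (u%:F - j * t) = b.
    by apply: (addrI (j ^+ m.+1 * t)); rewrite -uE exprS; ring.
  rewrite -bE in Ib.
  by case: (PM _ _ (TX _ m Tj) (ST _ St) Ib) => // /(Sz _ St).
(* Now [z J] lies in [x T], so [colonTJ] puts [z / x] in [T], although [z] is outside [x T]. *)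
apply: Nz; exists (x%:F^-1 * z); last by rewrite mulrA mulfV// mul1r.
apply: colonTJ => j /JN[t Tt tE].
by rewrite -mulrA [z * j]mulrC -tE mulrA mulVf// mul1r.
Qed.

End TPrimes.

(** * Strong t-stability and the Boole property *)

(** With [I = a T] one has [I I = a T I = a I] before any t-closure, and [a I] is already a t-ideal;
    thus [c] is [a]. *)
Lemma strongly_stable_idempotent (R : idomainType) (I : set {fraction R}) :
    t_ideal I -> strongly_stable I ->
  exists2 c, c != 0 & t_closure (prod_ideal I I) = scale c I.
Proof.
move=> tI [a IE]; have [[mI [x Ix x0] _] _] := tI; set T := colon I I in IE.
have a0 : a != 0.
  by apply: contraNneq x0 => a0; move: Ix; rewrite IE a0 => -[t _ <-]; rewrite mul0r.
exists a => //.
have IIE : prod_ideal I I = scale a I.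
  apply/seteqP; split; last first.
    move=> _ [i Ii <-]; apply: mem_prod => //.
    by rewrite IE; exists 1; rewrite ?mulr1// => y; rewrite mul1r.
  apply: prod_ideal_sub; first exact: submod_scale.
  move=> i j; rewrite {1}IE => -[t Tt <-] Ij.
  by exists (t * j); [exact: Tt|rewrite mulrA].
by rewrite IIE t_closure_scale//; case: tI => _ ->.
Qed.

(** The hypothesis [nonfieldR] excludes fields, which are strongly t-stable but have t-dimension
    0. *)
Theorem theorem2p6 (R : idomainType) (noethR : noetherian R)
    (nonfieldR : exists2 x : R, x != 0 & x \isn't a GRing.unit) :
  strongly_t_stable R <-> boole_t_regular R /\ t_dim_eq R 1.
Proof.
split=> [stR|[booleR [_ dim1]] I tI].
  split; last split.
  - elim/quotW => I; rewrite -[(_ * _)%g]/(tclass_mul _ _) -pi_tmul.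
    apply/eqmodP/asboolP.
    have [c c0 cE] := strongly_stable_idempotent (tidealP I) (stR _ (tidealP I)).
    by exists c.
  (* For a nonunit [x] the t-ideal [xR] misses 1, so some t-prime arises from it and gives a chain
     of length one. *)
  - have [x x0 xU] := nonfieldR.
    have x0' : x%:F != 0 by rewrite tofrac_eq0.
    have [||P [tP _ _]] := @t_prime_conductor R (scale x%:F (@ring_set R)) [set 1] 1
      noethR (t_ideal_scale x0' (t_ideal_ring R)) erefl.
    + by move=> _ _ -> ->; rewrite mulr1.
    + move=> _ -> [_ [r _ <-]]; rewrite mulr1 -rmorphM => /eqP.
      rewrite tofrac_eq => /eqP xr; move/negP: xU; apply.
      by apply/unitrPr; exists r.
    exists (fun n => if n is 0 then [set 0] else P); split => // -[|i]//= _.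
      have [[[P0 _ _] _ _] [[_ [_ [y Py <-] y0] _] _]] := (t_primeP P).1 tP.
      split; first by move=> _ ->.
      by move=> /(_ _ Py) yE; rewrite yE rmorph0 eqxx in y0.
  - move=> m P [_ Plt tP]; rewrite leqNgt; apply/negP => m2.
    have tP1 : t_prime (P 1%N) by apply: tP; rewrite (ltnW m2).
    have tP2 : t_prime (P 2%N) by apply: tP.
    have [pP1 [[_ [_ [y Py <-] y0] _] _]] := (t_primeP _).1 tP1.
    have [pP2 tI2] := (t_primeP _).1 tP2.
    have [P12 nP21] := Plt 1%N m2; apply: nP21.
    apply: (strongly_stable_prime_minimal noethR pP2 (stR _ tI2) pP1 P12 Py).
    by rewrite -(tofrac_eq0 y).
pose K := TIdeal (introT (asboolP _) tI).
have : (\pi_(tclass R) K = \pi_(tclass R) (tmul K K))%qT.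
  by rewrite pi_tmul; exact: booleR.
move=> /eqmodP/asboolP[c c0 /= cE].
have c0' : c^-1 != 0 by rewrite invr_neq0.
(* Dividing by [c] turns [(I I)_t = c I] into an exact idempotent. *)
pose J := scale c^-1 I.
have JJ : t_closure (prod_ideal J J) = J.
  rewrite prod_ideal_scale// prod_idealC prod_ideal_scale//.
  by rewrite !t_closure_scale// cE scaleK.
have J1 : J 1.
  apply: t_idempotent_mem1 => //; last exact: t_ideal_scale.
  move=> P Q tP tQ PQ; apply: contrapT => QP.
  pose chain n := match n with 0 => [set 0] | 1 => P | _ => Q end.
  suff /dim1 : t_prime_chain 2 chain by [].
  have [[[P0 _ _] _ _] [[_ [_ [y Py <-] y0] _] _]] := (t_primeP P).1 tP.
  split=> // [[|[|i]]//= _|[|[|i]]//].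
  split; first by move=> _ ->.
  by move=> /(_ _ Py) yE; rewrite yE rmorph0 eqxx in y0.
have IE : I = scale c J by rewrite /J scaleM mulfV// scale1.
have JM i j : J i -> J j -> J (i * j).
  move=> Ji Jj; rewrite -JJ; apply: t_closure_sub; last exact: mem_prod.
  by have [fJ _] := t_ideal_scale c0' tI; exact: frac_ideal_prod.
(* As [J] contains 1 and is closed under products, it is the endomorphism ring of [I = c J], which
   makes [c] the generator. *)
exists c; apply/seteqP; split.
  rewrite {1}IE; apply: scale_mono => i Ji y; rewrite {1}IE => -[j Jj <-].
  by rewrite IE; exists (i * j); [exact: JM|rewrite mulrCA].
move=> _ [t Tt <-]; have Ic : I c by rewrite IE; exists 1; rewrite ?mulr1.
by rewrite mulrC; exact: Tt.
Qed.
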